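(* For any base $D=(D_n)_{n=1}^\infty$ of neighborhoods in $[0,1]$, the space $X_D=(C[0,1],\|\cdot\|_D)$ is MLUR and has the D2P and the LD2P+.
   Context: $C[0,1]$ is the space of real-valued continuous functions on $[0,1]$. A base of neighborhoods in $[0,1]$ is a sequence $D=(D_n)_{n=1}^\infty$ of non-empty open subsets of $[0,1]$ forming a base for the topology of $[0,1]$. For $x\in C[0,1]$ put $\|x\|_n=\sup_{d\in D_n}|x(d)|$ and $$\|x\|_D=\Big(\sum_{n=1}^\infty 2^{-n}\|x\|_n^2\Big)^{1/2}.$$ This is a norm on $C[0,1]$ equivalent to the max-norm, and $X_D=(C[0,1],\|\cdot\|_D)$. For a Banach space $X$, $B_X$ and $S_X$ denote its closed unit ball and unit sphere. A slice of $B_X$ is a set $S(x^*,\varepsilon)=\{x\in B_X: x^*(x)>1-\varepsilon\}$ with $x^*\in S_{X^*}$ and $\varepsilon>0$. $X$ is midpoint locally uniformly rotund (MLUR) if for every $x\in S_X$ and every sequence $(x_n)$ in $X$ with $\|x+x_n\|\to 1$ and $\|x-x_n\|\to1$ one has $\|x_n\|\to 0$. $X$ has the diameter 2 property (D2P) if every non-empty relatively weakly open subset of $B_X$ has diameter $2$. $X$ has the local diameter 2 property + (LD2P+) if for every $x^*\in S_{X^*}$, every $\varepsilon>0$, every $\delta>0$ and every $x\in S(x^*,\varepsilon)\cap S_X$ there exists $y\in S(x^*,\varepsilon)$ with $\|x-y\|>2-\delta$. *)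

(* Defs.v *)
From HB Require Import structures.
From mathcomp Require Import all_boot all_order all_algebra.
From mathcomp Require Import all_classical all_reals all_analysis.
From mathcomp Require Import ring lra.

Set Implicit Arguments.
Unset Strict Implicit.
Unset Printing Implicit Defensive.

Import Order.TTheory GRing.Theory Num.Theory.
Import numFieldNormedType.Exports.

Local Open Scope classical_set_scope.
Local Open Scope ring_scope.

Section normed_space_properties.
Context {R : realType} (X : normedModType R).

Definition unit_ball : set X := [set x | `|x| <= 1].

Definition unit_sphere : set X := [set x | `|x| = 1].

Definition dual : Type := {f : {linear X -> R^o} | continuous f}.

Definition dual_fun (f : dual) : X -> R := sval f.

Coercion dual_fun : dual >-> Funclass.

Definition dual_norm (f : dual) : R := sup [set `|f x| | x in unit_ball].

Definition dual_sphere : set dual := [set f | dual_norm f = 1].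

Definition slice (f : dual) (e : R) : set X :=
  [set x | unit_ball x /\ 1 - e < f x].

(* [weak] is [X] with the coarsest topology making every [f : dual] continuous. *)
Definition weak : Type := X.

HB.instance Definition _ := Topological.copy weak
  (sup_topology (fun f : dual =>
    Topological.class (initial_topology (f : X -> R)))).

Definition relatively_weakly_open (W : set X) :=
  exists2 U : set weak, open U & W = U `&` unit_ball.

Definition diameter (A : set X) : \bar R :=
  ereal_sup [set d | exists x y, [/\ A x, A y & d = `|x - y|%:E]].

Definition MLUR := forall (x : X) (x_ : nat -> X), unit_sphere x ->
  `|x + x_ n| @[n --> \oo] --> (1 : R) ->
  `|x - x_ n| @[n --> \oo] --> (1 : R) ->
  `|x_ n| @[n --> \oo] --> (0 : R).

Definition D2P := forall W : set X, relatively_weakly_open W -> W !=set0 ->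
  diameter W = 2%:E.

Definition LD2Pplus := forall (f : dual) (e d : R) (x : X),
  dual_sphere f -> 0 < e -> 0 < d -> slice f e x -> unit_sphere x ->
  exists2 y, slice f e y & 2 - d < `|x - y|.

End normed_space_properties.

(* [set_type] carries the subspace topology, so openness of subsets of [I01]
   is relative to [0, 1]. *)
Definition I01 (R : realType) : Type := set_type (`[0, 1]%classic : set R).

HB.instance Definition _ (R : realType) := Topological.copy (I01 R)
  (set_type (`[0, 1]%classic : set R)).

(* Indexed from 0: [D n] is the set usually written D_{n+1}, whence the weight
   2^-(n+1) in [XD_norm]. Openness of the sets is part of [basis]. *)
Record nbhs_base (R : realType) := NbhsBase {
  nbhs_base_fun :> nat -> set (I01 R);
  nbhs_base_neq0 : forall n, nbhs_base_fun n !=set0;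
  nbhs_baseP : basis (range nbhs_base_fun) }.

Definition C01 (R : realType) : Type := continuousType (I01 R) R.

HB.instance Definition _ (R : realType) := gen_eqMixin (C01 R).
HB.instance Definition _ (R : realType) := gen_choiceMixin (C01 R).

Definition C01_fun {R : realType} (x : C01 R) : I01 R -> R :=
  (x : continuousType (I01 R) R).

Coercion C01_fun : C01 >-> Funclass.

Section C01_module.
Context {R : realType}.
Implicit Types (x y z : C01 R) (a b : R).

Lemma C01_continuous x : continuous (x : I01 R -> R).
Proof. exact: (@cts_fun _ _ (x : continuousType (I01 R) R)). Qed.

Lemma C01P x y : (forall t, x t = y t) -> x = y.
Proof. exact: (iffRL (@continuousEP (I01 R) R x y)). Qed.

Lemma C01_zero_subproof : continuous (cst 0 : I01 R -> R).
Proof. exact: cst_continuous. Qed.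

Lemma C01_opp_subproof x : continuous (fun t : I01 R => - x t : R).
Proof. by move=> t; exact: (cvgN (@C01_continuous x t)). Qed.

Lemma C01_add_subproof x y : continuous (fun t : I01 R => x t + y t : R).
Proof.
by move=> t; exact: (cvgD (@C01_continuous x t) (@C01_continuous y t)).
Qed.

Lemma C01_scale_subproof a x : continuous (fun t : I01 R => a * x t : R).
Proof. by move=> t; exact: (cvgMr (@C01_continuous x t)). Qed.

Definition C01_zero : C01 R :=
  (mkcts C01_zero_subproof : continuousType (I01 R) R).
Definition C01_opp x : C01 R :=
  (mkcts (@C01_opp_subproof x) : continuousType (I01 R) R).
Definition C01_add x y : C01 R :=
  (mkcts (@C01_add_subproof x y) : continuousType (I01 R) R).
Definition C01_scale a x : C01 R :=
  (mkcts (@C01_scale_subproof a x) : continuousType (I01 R) R).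

Fact C01_addA : associative C01_add.
Proof. by move=> x y z; apply: C01P => t; exact: addrA. Qed.

Fact C01_addC : commutative C01_add.
Proof. by move=> x y; apply: C01P => t; exact: addrC. Qed.

Fact C01_add0 : left_id C01_zero C01_add.
Proof. by move=> x; apply: C01P => t; exact: add0r. Qed.

Fact C01_addN : left_inverse C01_zero C01_opp C01_add.
Proof. by move=> x; apply: C01P => t; exact: addNr. Qed.

HB.instance Definition _ :=
  GRing.isZmodule.Build (C01 R) C01_addA C01_addC C01_add0 C01_addN.

Fact C01_scaleA a b x : C01_scale a (C01_scale b x) = C01_scale (a * b) x.
Proof. by apply: C01P => t; exact: mulrA. Qed.

Fact C01_scale1 : left_id 1 C01_scale.
Proof. by move=> x; apply: C01P => t; exact: mul1r. Qed.

Fact C01_scaleDr : right_distributive C01_scale +%R.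
Proof. by move=> a x y; apply: C01P => t; exact: mulrDr. Qed.

Fact C01_scaleDl x : {morph C01_scale^~ x : a b / a + b}.
Proof. by move=> a b; apply: C01P => t; exact: mulrDl. Qed.

HB.instance Definition _ := GRing.Zmodule_isLmodule.Build R (C01 R)
  C01_scaleA C01_scale1 C01_scaleDr C01_scaleDl.

Lemma C01_0E t : (0 : C01 R) t = 0. Proof. by []. Qed.
Lemma C01_NE x t : (- x) t = - x t. Proof. by []. Qed.
Lemma C01_DE x y t : (x + y) t = x t + y t. Proof. by []. Qed.
Lemma C01_ZE a x t : (a *: x) t = a * x t. Proof. by []. Qed.

End C01_module.

Definition XD {R : realType} (D : nbhs_base R) : Type := C01 R.

Section XD_normed.
Context {R : realType} (D : nbhs_base R).

HB.instance Definition _ := GRing.Lmodule.copy (XD D) (C01 R).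

Definition XD_fun (x : XD D) : I01 R -> R := C01_fun x.

Coercion XD_fun : XD >-> Funclass.

Implicit Types (x y : XD D) (n : nat).

Definition XD_seminorm n x : R := sup [set `|x d| | d in D n].

Definition XD_norm x : R :=
  Num.sqrt (limn (series (fun n => 2 ^- n.+1 * XD_seminorm n x ^+ 2))).

Let sq x n : R := series (fun n => 2 ^- n.+1 * XD_seminorm n x ^+ 2) n.

Lemma C01_bounded (x : C01 R) : exists M, forall t, `|x t| <= M.
Proof.
have /subspace_valL_continuousP cx := @C01_continuous R x.
have /compact_bounded[M [_ Mx]] :=
  continuous_compact cx (@segment_compact R 0 1).
exists (M + 1) => t; apply: (Mx (M + 1)); first by rewrite ltrDl.
exists (\val t); first exact/set_mem/(valP t).
by have /(congr1 (@^~ t)) := valLK point (x : I01 R -> R).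
Qed.

Lemma XD_seminorm_has_sup n x : has_sup [set `|x d| | d in D n].
Proof.
split; first by have [d Dd] := nbhs_base_neq0 D n; exists `|x d|, d.
by have [M xM] := C01_bounded x; exists M => _ [d _ <-]; exact: xM.
Qed.

Lemma XD_seminorm_ub n x d : D n d -> `|x d| <= XD_seminorm n x.
Proof.
move=> Dd; apply: ub_le_sup; first by have [] := XD_seminorm_has_sup n x.
by exists d.
Qed.

Lemma XD_seminorm_le n x M :
  (forall d, D n d -> `|x d| <= M) -> XD_seminorm n x <= M.
Proof.
move=> xM; apply: ge_sup; first by have [] := XD_seminorm_has_sup n x.
by move=> _ [d Dd <-]; exact: xM.
Qed.

Lemma XD_seminorm_ge0 n x : 0 <= XD_seminorm n x.
Proof.
have [d Dd] := nbhs_base_neq0 D n.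
exact: le_trans (normr_ge0 (x d)) (XD_seminorm_ub x Dd).
Qed.

Lemma XD_seminormD n x y :
  XD_seminorm n (x + y) <= XD_seminorm n x + XD_seminorm n y.
Proof.
apply: XD_seminorm_le => d Dd; rewrite [X in `|X|]C01_DE.
by apply: le_trans (ler_normD _ _) _; apply: lerD; exact: XD_seminorm_ub.
Qed.

Lemma XD_seminormZ n a x : XD_seminorm n (a *: x) = `|a| * XD_seminorm n x.
Proof.
apply/eqP; rewrite eq_le; apply/andP; split.
  apply: XD_seminorm_le => d Dd; rewrite [X in `|X|]C01_ZE normrM.
  by rewrite ler_wpM2l// XD_seminorm_ub.
have [->|a0] := eqVneq a 0; first by rewrite normr0 mul0r XD_seminorm_ge0.
rewrite mulrC -ler_pdivlMr ?normr_gt0//; apply: XD_seminorm_le => d Dd.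
rewrite ler_pdivlMr ?normr_gt0// mulrC -normrM -[_ * _]/((a *: x) d).
exact: XD_seminorm_ub.
Qed.

Let term_ge0 n x : 0 <= 2 ^- n.+1 * XD_seminorm n x ^+ 2.
Proof. by rewrite mulr_ge0 ?exprn_ge0 ?XD_seminorm_ge0// invr_ge0 exprn_ge0. Qed.

Let sq_nd x : nondecreasing_seq (sq x).
Proof. by apply: nondecreasing_series => n _ _; exact: term_ge0. Qed.

Lemma sum_half n : \sum_(0 <= k < n) (2 ^- k.+1 : R) = 1 - 2 ^- n.
Proof.
elim: n => [|n ih]; first by rewrite big_nil expr0 invr1 subrr.
rewrite big_nat_recr//= ih exprS invfM; have := @pnatr_eq0 R 2.
set u := (2 ^+ n)^-1 => _; lra.
Qed.

Lemma XD_series_cvg x :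
  cvgn (series (fun n => 2 ^- n.+1 * XD_seminorm n x ^+ 2)).
Proof.
apply: nondecreasing_is_cvgn; first exact: sq_nd.
have [M xM] := C01_bounded x; exists (M ^+ 2) => _ [n _ <-] /=.
have M0 : 0 <= M.
  have [d _] := nbhs_base_neq0 D 0; exact: le_trans (normr_ge0 _) (xM d).
rewrite seriesEnat/=.
apply: (@le_trans _ _ (\sum_(0 <= k < n) (2 ^- k.+1 * M ^+ 2))).
  apply: ler_sum => k _; rewrite ler_wpM2l ?invr_ge0 ?exprn_ge0//.
  rewrite ler_pXn2r ?nnegrE ?XD_seminorm_ge0//.
  by apply: XD_seminorm_le => d _; exact: xM.
by rewrite -mulr_suml sum_half ler_piMl ?exprn_ge0// gerBl invr_ge0 exprn_ge0.
Qed.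

Let sq_le x n : sq x n <= XD_norm x ^+ 2.
Proof.
have le_lim k : sq x k <= limn (sq x).
  by apply: nondecreasing_cvgn_le; [exact: sq_nd|exact: XD_series_cvg].
rewrite sqr_sqrtr//; apply: le_trans (le_lim 0).
by rewrite /sq seriesEnat/= big_nil.
Qed.

Let norm_le x M : 0 <= M -> (forall n, sq x n <= M ^+ 2) -> XD_norm x <= M.
Proof.
move=> M0 xM; rewrite -(ger0_norm M0) -sqrtr_sqr.
by apply: ler_wsqrtr; apply: limr_le; [exact: XD_series_cvg|exact: nearW].
Qed.

Lemma XD_norm_ge0 x : 0 <= XD_norm x.
Proof. exact: sqrtr_ge0. Qed.

Lemma XD_norm0_eq0 x : XD_norm x = 0 -> x = 0.
Proof.
move=> x0; apply: C01P => t; apply/eqP; apply: contraT => xt0.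
have [_ /(_ t)/= Dt] := nbhs_baseP D.
have [_ [[n _ <-] Dnt] _] := Dt _ (@filterT _ (nbhs t) _).
have := sq_le x n.+1; rewrite x0 expr0n/= /sq seriesEnat/=.
rewrite big_nat_recr//= leNgt => /negP[]; apply: ltr_wpDl.
  by apply: sumr_ge0 => k _; exact: term_ge0.
rewrite mulr_gt0 ?invr_gt0 ?exprn_gt0//.
by apply: lt_le_trans (XD_seminorm_ub x Dnt); rewrite normr_gt0.
Qed.

Let sqD x y a b n : 0 < a -> 0 < b ->
  sq (x + y) n <= (a + b) * (sq x n / a + sq y n / b).
Proof.
move=> a0 b0; rewrite /sq !seriesEnat/= 2!mulr_suml -big_split/= mulr_sumr.
apply: ler_sum => k _; set c := 2 ^- k.+1.
set u := XD_seminorm k x; set v := XD_seminorm k y.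
have c0 : 0 <= c by rewrite invr_ge0 exprn_ge0.
have -> : (a + b) * (c * u ^+ 2 / a + c * v ^+ 2 / b) =
    c * ((u + v) ^+ 2 + (b * u - a * v) ^+ 2 / (a * b)).
  by field; rewrite !gt_eqF.
rewrite ler_wpM2l// (@le_trans _ _ ((u + v) ^+ 2))//.
  rewrite ler_pXn2r ?nnegrE ?addr_ge0 ?XD_seminorm_ge0//.
  exact: XD_seminormD.
by rewrite lerDl mulr_ge0 ?sqr_ge0// invr_ge0 ltW// mulr_gt0.
Qed.

Lemma XD_normD x y : XD_norm (x + y) <= XD_norm x + XD_norm y.
Proof.
have [/XD_norm0_eq0 ->|x0] := eqVneq (XD_norm x) 0.
  by rewrite add0r lerDr XD_norm_ge0.
have [/XD_norm0_eq0 ->|y0] := eqVneq (XD_norm y) 0.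
  by rewrite addr0 lerDl XD_norm_ge0.
have {}x0 : 0 < XD_norm x by rewrite lt_def x0 XD_norm_ge0.
have {}y0 : 0 < XD_norm y by rewrite lt_def y0 XD_norm_ge0.
apply: norm_le => [|n]; first by rewrite addr_ge0 ?XD_norm_ge0.
apply: le_trans (sqD x y n x0 y0) _; rewrite expr2 ler_wpM2l//.
  by rewrite addr_ge0 ?XD_norm_ge0.
by apply: lerD; rewrite ler_pdivrMr// -expr2; exact: sq_le.
Qed.

Lemma XD_normZ a x : XD_norm (a *: x) = `|a| * XD_norm x.
Proof.
rewrite -(sqrtr_sqr a) -sqrtrM ?sqr_ge0//; congr Num.sqrt.
rewrite -[RHS]/(a ^+ 2 *: _) -lim_seriesZ; last exact: XD_series_cvg.
congr (limn (series _)); apply/funext => n /=.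
by rewrite XD_seminormZ exprMn real_normK ?num_real// mulrCA.
Qed.

HB.instance Definition _ := @Lmodule_isNormed.Build R (XD D) XD_norm
  XD_normD XD_normZ XD_norm0_eq0.

End XD_normed.

(* Main.v *)
Require Import Defs.
From mathcomp Require Import all_boot all_order all_algebra.
From mathcomp Require Import all_classical all_reals all_analysis.
From mathcomp Require Import ring lra.

(** Midpoint local uniform rotundity comes from convexity in each seminorm.  If
    [`|x + y n|] and [`|x - y n|] both tend to [`|x| = 1], the quantity
    [2 * `|x + y n| ^+ 2 + 2 * `|x - y n| ^+ 2 - 4 * `|x| ^+ 2] tends to 0.  It is
    a weighted sum of the analogous quantities for the seminorms over the sets
    [D k], and these are nonnegative, so each of them tends to 0; this forces both
    seminorms of [x + y n] and [x - y n] to have upper limit at most that of [x]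
    ([XD_seminorm_midpoint]).  On a set [D k] where [x] oscillates little, the
    seminorm of [x] is nearly [`|x d|] for every [d] in [D k], and since
    [`|x d| + `|y n d|] is the larger of [`|x d + y n d|] and [`|x d - y n d|], the
    values [y n d] are small.  Compactness of [0, 1] makes this uniform
    ([XD_MLUR]).

    Both diameter properties come from [XD_weakly_null_pieces]: every [x] admits a
    weakly null sequence [h] with [`|x - 2 *: h j| <= `|x|] and [`|h j|] as close
    to [`|x|] as desired.  Such an [h j] is [phi j * x], where the [phi j] are
    nonnegative continuous functions with all partial sums at most 1
    ([summable_bumps]).  The bound on the partial sums bounds every signed sum of
    the [h j] by [`|x|], and a functional is then absolutely summable along [h]
    ([bounded_sign_sums_weakly_null]).  Moreover every [phi j] takes the value 1 in
    each of finitely many prescribed open sets, namely the places in [D k], for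
    [k] below some [N], where [x] nearly attains its seminorm; so [h j] has nearly
    the norm of [x].  In a slice or a weakly open set, a point [x] of the unit
    sphere can therefore be moved to [x - 2 *: h j], at distance almost 2, without
    leaving the unit ball.  For weakly open sets, a point of the unit sphere is
    first obtained by adding multiples of a weakly null sequence that is bounded
    away from 0 ([XD_sphere_weakly_dense]). *)

Set Implicit Arguments.
Unset Strict Implicit.
Unset Printing Implicit Defensive.

Import Order.TTheory GRing.Theory Num.Theory.
Import numFieldNormedType.Exports.

Local Open Scope classical_set_scope.
Local Open Scope ring_scope.

(** * The norm of [XD D] and its seminorms *)

Section XD_norm_theory.
Context {R : realType} (D : nbhs_base R).
Implicit Types x y : XD D.

Lemma XD_DE x y t : XD_fun (x + y) t = x t + y t. Proof. by []. Qed.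

Lemma XD_NE x t : XD_fun (- x) t = - x t. Proof. by []. Qed.

Lemma XD_ZE a x t : XD_fun (a *: x) t = a * x t. Proof. by []. Qed.

Lemma XD_sumE n (h : nat -> XD D) t :
  XD_fun (\sum_(0 <= j < n) h j) t = \sum_(0 <= j < n) h j t.
Proof.
by rewrite (big_morph (fun x : XD D => x t) (fun x y => XD_DE x y t) erefl).
Qed.

Lemma XD_sqnorm_cvg x :
  \sum_(0 <= k < n) 2 ^- k.+1 * XD_seminorm k x ^+ 2 @[n --> \oo]
  --> `|x| ^+ 2.
Proof.
have -> : `|x| ^+ 2 =
    limn (series (fun k => 2 ^- k.+1 * XD_seminorm k x ^+ 2)).
  rewrite sqr_sqrtr//; apply: limr_ge; first exact: XD_series_cvg.
  apply: nearW => n; rewrite seriesEnat; apply: sumr_ge0 => k _.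
  by rewrite mulr_ge0 ?exprn_ge0 ?XD_seminorm_ge0// invr_ge0 exprn_ge0.
by have := @XD_series_cvg R D x; rewrite seriesEnat.
Qed.

Lemma ler_XD_norm x y :
  (forall k, XD_seminorm k x <= XD_seminorm k y) -> `|x| <= `|y|.
Proof.
move=> xy; apply: ler_wsqrtr; apply: lim_series_le; try exact: XD_series_cvg.
move=> k; rewrite ler_wpM2l ?invr_ge0 ?exprn_ge0//.
by rewrite ler_pXn2r ?nnegrE ?XD_seminorm_ge0.
Qed.

Lemma ler_XD_norm_fun x y : (forall t, `|x t| <= `|y t|) -> `|x| <= `|y|.
Proof.
move=> xy; apply: ler_XD_norm => k; apply: XD_seminorm_le => d Dd.
exact: le_trans (xy d) (XD_seminorm_ub y Dd).
Qed.

Lemma XD_norm_le_sup x (M : R) : 0 <= M -> (forall t, `|x t| <= M) -> `|x| <= M.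
Proof.
move=> M0 xM; rewrite -(ler_pXn2r (ltn0Sn 1)) ?nnegrE//.
apply: (cvgr_to_le (@XD_sqnorm_cvg x)); apply: nearW => n.
apply: (@le_trans _ _ (\sum_(0 <= k < n) (2 ^- k.+1 * M ^+ 2))).
  apply: ler_sum => k _; rewrite ler_wpM2l ?invr_ge0 ?exprn_ge0//.
  rewrite ler_pXn2r ?nnegrE ?XD_seminorm_ge0//.
  by apply: XD_seminorm_le => d _; exact: xM.
by rewrite -mulr_suml sum_half ler_piMl ?exprn_ge0// gerBl invr_ge0 exprn_ge0.
Qed.

Lemma XD_seminorm_midpoint_le k x y :
  2 * XD_seminorm k x <= XD_seminorm k (x + y) + XD_seminorm k (x - y).
Proof.
rewrite -[2]ger0_norm// -XD_seminormZ.
have -> : 2 *: x = (x + y) + (x - y) by rewrite addrACA subrr addr0 scaler_nat.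
exact: XD_seminormD.
Qed.

Lemma XD_midpoint_defect_ge0 k x y :
  0 <= 2 * XD_seminorm k (x + y) ^+ 2 + 2 * XD_seminorm k (x - y) ^+ 2
       - 4 * XD_seminorm k x ^+ 2.
Proof.
have := XD_seminorm_midpoint_le k x y; have := XD_seminorm_ge0 k x.
set a := XD_seminorm _ (x + y); set b := XD_seminorm _ (x - y).
set c := XD_seminorm _ x => c0 cab.
have : 0 <= (a - b) ^+ 2 by exact: sqr_ge0.
have : 0 <= (a + b - 2 * c) * (a + b + 2 * c).
  by rewrite mulr_ge0// ?subr_ge0//; lra.
nra.
Qed.

(** Since the norm is the weighted square sum of the seminorms and all their
    midpoint defects are nonnegative, that of the norm dominates each of them. *)
Lemma XD_midpoint_defect_le k x y :
  2 ^- k.+1 * (2 * XD_seminorm k (x + y) ^+ 2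
    + 2 * XD_seminorm k (x - y) ^+ 2 - 4 * XD_seminorm k x ^+ 2)
  <= 2 * `|x + y| ^+ 2 + 2 * `|x - y| ^+ 2 - 4 * `|x| ^+ 2.
Proof.
pose u j := 2 ^- j.+1 * (2 * XD_seminorm j (x + y) ^+ 2
    + 2 * XD_seminorm j (x - y) ^+ 2 - 4 * XD_seminorm j x ^+ 2).
have u0 j : 0 <= u j.
  by rewrite mulr_ge0 ?XD_midpoint_defect_ge0// invr_ge0 exprn_ge0.
have uE : \sum_(0 <= j < n) u j @[n --> \oo] -->
    2 * `|x + y| ^+ 2 + 2 * `|x - y| ^+ 2 - 4 * `|x| ^+ 2.
  pose s (z : XD D) n : R := \sum_(0 <= j < n) 2 ^- j.+1 * XD_seminorm j z ^+ 2.
  have -> : (fun n => \sum_(0 <= j < n) u j) =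
      (fun n => 2 * s (x + y) n + 2 * s (x - y) n - 4 * s x n).
    apply/funext => n; rewrite /s !mulr_sumr -big_split/= -sumrB.
    by apply: eq_bigr => j _; rewrite /u; ring.
  by apply: cvgB; [apply: cvgD|]; apply: cvgMr; exact: XD_sqnorm_cvg.
rewrite -[leLHS]/(u k); apply: (cvgr_to_ge uE).
exists k.+1 => // n /= kn; rewrite (big_cat_nat (n := k.+1))//=.
rewrite big_nat_recr//= -addrA addrCA lerDl addr_ge0//; exact: sumr_ge0.
Qed.

End XD_norm_theory.

(** * The unit interval as a topological space *)

Section I01_topology.
Context {R : realType}.

Lemma I01_val_continuous : continuous (fun t : I01 R => \val t : R).
Proof. exact: initial_continuous. Qed.

Lemma I01_openP (A : set (I01 R)) : open A ->
  exists2 O : set R, open O & A = (fun t : I01 R => \val t : R) @^-1` O.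
Proof. by case=> O oO <-; exists O. Qed.

Lemma I01P (s : R) : 0 <= s <= 1 -> exists t : I01 R, \val t = s.
Proof.
move=> s01; have sI : s \in (`[0, 1]%classic : set R).
  by rewrite inE/= in_itv.
by exists (SigSub sI).
Qed.

Lemma I01_compact : compact [set: I01 R].
Proof.
apply/compact_near_coveringP => I F P FF cov.
have /compact_near_coveringP/(_ I F
    (fun i s => forall t : I01 R, \val t = s -> P i t) FF) :=
  @segment_compact R 0 1.
have cov' (s : R) : `[0, 1]%classic s -> \near s & F,
    forall t : I01 R, \val t = s -> P F t.
  rewrite /= in_itv => /I01P[t <-].
  have [[A B] /= [tA FB] AB] := cov t Logic.I.
  move: tA; rewrite nbhsE => -[U [/I01_openP[V oV UV] tU] UA].
  move: tU UA; rewrite {}UV /= => tV UA.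
  exists (V, B); first by split => //=; exact: open_nbhs_nbhs.
  by move=> [r i]/= [Vr Bi] u ur; apply: (AB (u, i)); split => //=;
    apply: UA => /=; rewrite ur.
move=> /(_ cov'); apply: filterS => i Pi t _; apply: (Pi (\val t)) => //.
exact/set_mem/(valP t).
Qed.

End I01_topology.

(** * Midpoint local uniform rotundity *)

Section XD_MLUR.
Context {R : realType} (D : nbhs_base R).
Implicit Types x y : XD D.

Lemma XD_continuous x : continuous (x : I01 R -> R).
Proof. exact: C01_continuous. Qed.

Lemma nbhs_base_oscillation x t (e : R) : 0 < e ->
  exists k, D k t /\ forall d d', D k d -> D k d' -> `|x d - x d'| <= e.
Proof.
move=> e0; have [_ /(_ t) Dt] := nbhs_baseP D.
have e20 : 0 < e / 2 by rewrite divr_gt0.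
have [_ [[k _ <-] Dkt] Dk] :=
  Dt _ (@cvgr_dist_lt _ _ _ _ _ _ _ (@XD_continuous x t) _ e20).
exists k; split => // d d' /Dk/= xd /Dk/= xd'.
rewrite (le_trans (ler_distD (x t) _ _))// (distrC (x d)).
by rewrite [e]splitr lerD// ltW.
Qed.

Lemma XD_seminorm_midpoint x (y : nat -> XD D) k (e : R) :
  unit_sphere x -> 0 < e ->
  `|x + y n| @[n --> \oo] --> (1 : R) -> `|x - y n| @[n --> \oo] --> (1 : R) ->
  \forall n \near \oo, XD_seminorm k (x + y n) <= XD_seminorm k x + e /\
                       XD_seminorm k (x - y n) <= XD_seminorm k x + e.
Proof.
move=> x1 e0 py my.
have c0 : 0 < 2 ^- k.+1 * e ^+ 2 :> R.
  by rewrite mulr_gt0 ?exprn_gt0// invr_gt0 exprn_gt0.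
have lim0 : 2 * `|x + y n| ^+ 2 + 2 * `|x - y n| ^+ 2 - 4 * `|x| ^+ 2
    @[n --> \oo] --> (0 : R).
  have -> : 0 = 2 * 1 ^+ 2 + 2 * 1 ^+ 2 - 4 * `|x| ^+ 2 by rewrite x1; ring.
  apply: cvgB; last exact: cvg_cst.
  by apply: cvgD; apply: cvgMr; rewrite !expr2; exact: cvgM.
apply: filterS (cvgr_lt _ lim0 _ c0) => n yn.
have := le_lt_trans (XD_midpoint_defect_le k x (y n)) yn.
rewrite ltr_pM2l ?invr_gt0 ?exprn_gt0//.
have := XD_seminorm_midpoint_le k x (y n).
have := XD_seminorm_ge0 k (x + y n); have := XD_seminorm_ge0 k (x - y n).
have := XD_seminorm_ge0 k x.
set a := XD_seminorm _ (x + y n); set b := XD_seminorm _ (x - y n).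
set c := XD_seminorm _ x => c_ge0 b0 a0 cab abc.
(* From [2 * a ^+ 2 + 2 * b ^+ 2 < 4 * c ^+ 2 + e ^+ 2] and [2 * c <= a + b], both
   [a - b] and [a + b - 2 * c] are at most [e]. *)
have ab : `|a - b| <= e.
  rewrite -(ler_pXn2r (ltn0Sn 1)) ?nnegrE// ?ltW// real_normK ?num_real//.
  have : 0 <= (a + b - 2 * c) * (a + b + 2 * c).
    by rewrite mulr_ge0// ?subr_ge0//; lra.
  nra.
have abc' : a + b <= 2 * c + e.
  rewrite -(ler_pXn2r (ltn0Sn 1)) ?nnegrE; last 2 first.
    - by lra.
    - by lra.
  have := sqr_ge0 (a - b); nra.
by move: ab; rewrite ler_norml => /andP[? ?]; split; lra.
Qed.

Lemma XD_MLUR : MLUR (XD D).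
Proof.
move=> x y x1 py my; apply/cvgr0Pnorm_le => e e0.
have e20 : 0 < e / 2 by rewrite divr_gt0.
suff : \forall n \near \oo, forall t, `|y n t| <= e.
  apply: filterS => n yn; rewrite normr_id.
  by apply: XD_norm_le_sup => //; exact: ltW.
have /compact_near_coveringP cover := @I01_compact R.
suff : \forall n \near \oo, [set: I01 R] `<=` (fun t => `|y n t| <= e).
  by apply: filterS => n yn t; exact: yn.
apply: (cover _ _ (fun n t => `|y n t| <= e)).
move=> t _; have [k [Dkt xosc]] := nbhs_base_oscillation x t e20.
have := XD_seminorm_midpoint k x1 e20 py my => yk.
exists (D k, [set n | XD_seminorm k (x + y n) <= XD_seminorm k x + e / 2 /\
                      XD_seminorm k (x - y n) <= XD_seminorm k x + e / 2]).
  split => //=; apply: open_nbhs_nbhs; split => //.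
  by have [+ _] := nbhs_baseP D; apply; exists k.
move=> [d n]/= [Dd [yp ym]].
(* The oscillation of [x] on [D k] is at most [e / 2]. *)
have xd : XD_seminorm k x <= `|x d| + e / 2.
  apply: XD_seminorm_le => d' Dd'; rewrite -lerBlDl.
  by rewrite (le_trans (lerB_dist _ _))// xosc.
have := le_trans (XD_seminorm_ub (x + y n) Dd) yp.
have := le_trans (XD_seminorm_ub (x - y n) Dd) ym.
rewrite !XD_DE XD_NE => ym' yp'.
have := ler_norm (x d + y n d); have := ler_norm (x d - y n d).
have := ler_norm (- (x d + y n d)); have := ler_norm (- (x d - y n d)).
rewrite !normrN ler_norml.
by case: (ger0P (x d)) xd => _ xd; lra.
Qed.

End XD_MLUR.

(** * Bumps with bounded sums peaking in given open sets *)

Section bumps.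
Context {R : realType}.

Lemma I01_open_segment (V : set (I01 R)) : open V -> V !=set0 ->
  exists a b : R, a < b /\ forall s, a <= s <= b -> exists2 t, V t & \val t = s.
Proof.
move=> /I01_openP[W oW ->] [t /= Wt].
have : `[0, 1]%classic (\val t : R) by exact/set_mem/(valP t).
rewrite /= in_itv/=.
move: (\val t : R) Wt => v Wv /andP[v0 v1].
have /nbhs_ballP[e /= e0 eW] : nbhs v W by exact: open_nbhs_nbhs.
exists (Num.max 0 (v - e / 2)), (Num.min 1 (v + e / 2)); split.
  by rewrite lt_min !gt_max; apply/andP; split; apply/andP; split; lra.
move=> s; rewrite ge_max le_min => /andP[/andP[s0 vs] /andP[s1 sv]].
have [u us] : exists u : I01 R, \val u = s by apply: I01P; rewrite s0.
exists u => //=; rewrite us; apply: eW.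
by rewrite /ball/= ltr_norml; apply/andP; split; lra.
Qed.

Lemma poly_nonroot_itv (p : {poly R}) (a b : R) : p != 0 -> a < b ->
  exists2 q, a <= q <= b & p.[q] != 0.
Proof.
move=> p0 ab; apply: contrapT => noq.
have ba0 : 0 < b - a by rewrite subr_gt0.
pose rs := [seq a + (b - a) / i.+1%:R | i <- iota 0 (size p)].
have : (size rs < size p)%N.
  apply: (@max_poly_roots _ p) => //.
  - apply/allP => _ /mapP[i _ ->]; rewrite -[X in is_true X]negbK.
    apply/negP => pq.
    apply: noq; exists (a + (b - a) / i.+1%:R) => //.
    rewrite lerDl (divr_ge0 (ltW ba0) (ler0n _ _))/= -lerBrDl ler_pdivrMr//.
    by rewrite ler_peMr ?ler1n// ltW.
  - rewrite map_inj_uniq ?iota_uniq// => i j /addrI.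
    move=> /(mulfI (lt0r_neq0 ba0))/invr_inj/eqP.
    by rewrite eqr_nat => /eqP[].
by rewrite size_map size_iota ltnn.
Qed.

(** A single nonnegative function [g] takes all values between 0 and 1 in each of
    finitely many open sets: a large multiple of the square of a polynomial
    vanishing at one point of each set. *)
Lemma open_common_values (N : nat) (V : nat -> set (I01 R)) :
  (forall k, open (V k)) -> (forall k, V k !=set0) ->
  exists g : R -> R, [/\ continuous g, forall s, 0 <= g s &
    forall k v, (k < N)%N -> 0 <= v <= 1 ->
      exists2 t, V k t & g (\val t) = v].
Proof.
move=> oV V0.
have /choice[ab abP] k : exists ab : R * R, ab.1 < ab.2 /\
    forall s, ab.1 <= s <= ab.2 -> exists2 t, V k t & \val t = s.
  by have [a [b abV]] := I01_open_segment (oV k) (V0 k); exists (a, b).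
pose p : {poly R} := \prod_(k < N) ('X - (ab k).1%:P).
have p0 : p != 0 by rewrite monic_neq0// monic_prod_XsubC.
have /choice[q qP] k : exists q, (ab k).1 <= q <= (ab k).2 /\ p.[q] != 0.
  by have [abk _] := abP k; have [q] := poly_nonroot_itv p0 abk; exists q.
(* This constant makes [c * p.[q k] ^+ 2] at least 1 for every [k < N]. *)
pose c := 1 + \sum_(k < N) p.[q k] ^- 2.
have c0 : 0 <= c.
  by rewrite addr_ge0// sumr_ge0// => k _; rewrite invr_ge0 sqr_ge0.
exists (fun s => c * p.[s] ^+ 2); split.
- move=> s; apply: cvgMr; rewrite expr2; apply: cvgM; exact: continuous_horner.
- by move=> s; rewrite mulr_ge0 ?sqr_ge0.
- move=> k v kN /andP[v0 v1].
  have [abk abV] := abP k; have [/andP[aq qb] pq] := qP k.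
  have pa : p.[(ab k).1] = 0.
    rewrite horner_prod (bigD1 (Ordinal kN))//=.
    by rewrite hornerXsubC subrr mul0r.
  have gq : 1 <= c * p.[q k] ^+ 2.
    have pq2 : 0 < p.[q k] ^+ 2 by rewrite exprn_even_gt0.
    rewrite -ler_pdivrMr// mul1r /c (bigD1 (Ordinal kN))//= addrCA lerDl.
    by rewrite addr_ge0// sumr_ge0// => i _; rewrite invr_ge0 sqr_ge0.
  have [||s] := @IVT _ (fun s => c * p.[s] ^+ 2) (ab k).1 (q k) v aq.
  - apply: continuous_subspaceT => s.
    apply: cvgMr; rewrite expr2; apply: cvgM; exact: continuous_horner.
  - rewrite pa expr0n/= mulr0 ge_min le_max v0/=.
    by rewrite (le_trans v1 gq) orbT.
  - rewrite in_itv/= => /andP[as_ sq] gs.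
    have [|t Vt ts] := abV s; first by rewrite as_ (le_trans sq).
    by exists t => //; rewrite ts.
Qed.

(** The piecewise linear function equal to 1 up to 1 and to 0 from 2 on. *)
Definition ramp (s : R) : R := (1 + `|2 - s| - `|1 - s|) / 2.

Lemma ramp_continuous : continuous ramp.
Proof.
move=> s; apply: cvgMl; apply: cvgB; [apply: cvgD|]; first exact: cvg_cst.
  by apply: cvg_norm; apply: cvgB; [exact: cvg_cst|exact: cvg_id].
by apply: cvg_norm; apply: cvgB; [exact: cvg_cst|exact: cvg_id].
Qed.

Lemma ramp_ge0 s : 0 <= ramp s.
Proof. by rewrite /ramp; case: (ger0P (2 - s)); case: (ger0P (1 - s)); lra. Qed.

Lemma ramp_le1 s : ramp s <= 1.
Proof. by rewrite /ramp; case: (ger0P (2 - s)); case: (ger0P (1 - s)); lra. Qed.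

Lemma ramp1 : ramp 1 = 1.
Proof.
by rewrite /ramp; case: (ger0P (2 - 1 : R)); case: (ger0P (1 - 1 : R)); lra.
Qed.

Lemma ramp2 : ramp 2 = 0.
Proof.
by rewrite /ramp; case: (ger0P (2 - 2 : R)); case: (ger0P (1 - 2 : R)); lra.
Qed.

Lemma ramp_nincr s s' : s <= s' -> ramp s' <= ramp s.
Proof.
rewrite /ramp; case: (ger0P (2 - s)); case: (ger0P (1 - s));
case: (ger0P (2 - s')); case: (ger0P (1 - s')); lra.
Qed.

(** A continuous function on [I01 R], seen as an element of [C01 R]. *)
Definition C01_mk (f : I01 R -> R) (cf : continuous f) : C01 R :=
  (mkcts cf : continuousType (I01 R) R).

Lemma C01_mkE f (cf : continuous f) t : C01_mk cf t = f t. Proof. by []. Qed.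

(** The bumps are [phi j = ramp (2 ^+ j * g) - ramp (2 ^+ j.+1 * g)]: their sums
    telescope, and [phi j] equals 1 where [g] equals [2 ^- j]. *)
Lemma summable_bumps (N : nat) (V : nat -> set (I01 R)) :
  (forall k, open (V k)) -> (forall k, V k !=set0) ->
  exists phi : nat -> C01 R,
    [/\ forall j t, 0 <= phi j t,
        forall n t, \sum_(0 <= j < n) phi j t <= 1 &
        forall j k, (k < N)%N -> exists2 t, V k t & phi j t = 1].
Proof.
move=> oV V0; have [g [gc g0 gV]] := open_common_values N oV V0.
pose u j (t : I01 R) : R := ramp (2 ^+ j * g (\val t)).
have uc j : continuous (u j).
  have ugc : continuous (fun s => ramp (2 ^+ j * g s)).
    move=> s; apply: (@continuous_comp _ _ _ (fun s => 2 ^+ j * g s) ramp).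
      by apply: cvgMr; exact: gc.
    exact: ramp_continuous.
  by move=> t; exact: (continuous_comp (@I01_val_continuous R t) (ugc _)).
have phic j : continuous (fun t => u j t - u j.+1 t).
  by move=> t; exact: (cvgB (@uc j t) (@uc j.+1 t)).
exists (fun j => C01_mk (phic j)); split.
- move=> j t; rewrite C01_mkE subr_ge0; apply: ramp_nincr.
  by rewrite ler_wpM2r// exprS ler_peMl ?exprn_ge0// ler1n.
- move=> n t; under eq_bigr do rewrite C01_mkE.
  rewrite (@telescope_sumr_eq _ 0 n (fun j => - u j t))//; last first.
    by move=> j _; rewrite opprK addrC.
  rewrite opprK addrC (le_trans _ (ramp_le1 (2 ^+ 0 * g (\val t))))//.
  by rewrite gerBl ramp_ge0.
- move=> j k kN; have [|t Vt gt] := gV k (2 ^- j) kN.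
    rewrite invr_ge0 exprn_ge0//= invf_le1 ?exprn_gt0//.
    by rewrite exprn_ege1// ler1n.
  exists t => //; rewrite C01_mkE /u gt exprS -mulrA mulfV ?mulr1.
    by rewrite ramp1 ramp2 subr0.
  by rewrite expf_neq0.
Qed.

End bumps.

(** * Weakly null sequences *)

Section weak_topology.
Context {R : realType} {X : normedModType R}.
Implicit Types (f : dual X) (h : nat -> X).

(** Convergence to 0 along every continuous linear functional. *)
Definition weakly_null h := forall f, f (h n) @[n --> \oo] --> (0 : R).

Lemma dualD f x y : f (x + y) = f x + f y.
Proof. exact: linearD (sval f) x y. Qed.

Lemma dualZ f a x : f (a *: x) = a * f x.
Proof. exact: (linearZZ (sval f) a x). Qed.

Lemma dual_sum f n h : f (\sum_(0 <= j < n) h j) = \sum_(0 <= j < n) f (h j).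
Proof. exact: (linear_sum (sval f)). Qed.

Lemma dual_bounded f : exists r : R, forall x, `|f x| <= r * `|x|.
Proof.
have /linear_boundedP : bounded_near (sval f) (nbhs (0 : X)).
  by apply: continuous_linear_bounded; exact: (svalP f).
by move=> [r [_ fr]]; exists (r + 1) => x; apply: fr; rewrite ltrDl.
Qed.

Lemma weakly_nullZ h (c : nat -> R) K : (forall n, `|c n| <= K) ->
  weakly_null h -> weakly_null (fun n => c n *: h n).
Proof.
move=> cK h0 f; apply/cvgr0Pnorm_le => e e0.
have K0 : 0 < K + 1 by rewrite ltr_wpDl// (le_trans _ (cK 0%N)).
have /cvgr0Pnorm_le/(_ (e / (K + 1)) (divr_gt0 e0 K0)) := h0 f.
apply: filterS => n; rewrite dualZ normrM ler_pdivlMr// mulrC => fh.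
by rewrite (le_trans _ fh)// ler_wpM2r// (le_trans (cK n))// lerDl.
Qed.

(** Translating by a weakly null sequence eventually stays in a weakly open set. *)
Lemma weakly_null_shift (U : set (weak X)) (x : X) h : open U -> U x ->
  weakly_null h -> \forall n \near \oo, U (x + h n).
Proof.
move=> oU Ux h0.
have : (fun n => x + h n : weak X) @ \oo --> (x : weak X).
  apply/cvg_sup => f A; rewrite nbhsE => -[B [[V oV <-] /= Vx] BA].
  have : \forall n \near \oo, V (f (x + h n)).
    have : f (x + h n) @[n --> \oo] --> f x.
      rewrite -[X in _ --> X]addr0; under eq_fun do rewrite dualD.
      by apply: cvgD; [exact: cvg_cst|exact: h0].
    by apply; exact: open_nbhs_nbhs.
  by apply: filterS => n Vn; apply: BA.
by apply; exact: open_nbhs_nbhs.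
Qed.

(** The functional [f], applied to the sum of the [h j] signed by the values
    [f (h j)], bounds the partial sums of [`|f (h j)|]. *)
Lemma bounded_sign_sums_weakly_null h (C : R) :
  (forall n (s : nat -> R), (forall j, `|s j| <= 1) ->
    `|\sum_(0 <= j < n) s j *: h j| <= C) ->
  weakly_null h.
Proof.
move=> hC f; have [r fr] := dual_bounded f.
apply: norm_cvg0; apply: cvg_series_cvg_0; apply: nondecreasing_is_cvgn.
  by apply: nondecreasing_series => n _ _.
exists (`|r| * C) => _ [n _ <-]; rewrite seriesEnat/=.
have -> : \sum_(0 <= j < n) `|f (h j)| =
    f (\sum_(0 <= j < n) Num.sg (f (h j)) *: h j).
  by rewrite dual_sum; apply: eq_bigr => j _; rewrite dualZ normrEsg.
rewrite (le_trans (ler_norm _))// (le_trans (fr _))//.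
rewrite (le_trans (ler_wpM2r _ (ler_norm r)))// ler_wpM2l//.
by apply: hC => j; rewrite normr_sg; case: eqP.
Qed.

End weak_topology.

(** * Weakly null pieces of a function and the diameter properties *)

Section XD_diameter.
Context {R : realType} (D : nbhs_base R).
Implicit Types x y : XD D.

Lemma XD_partial_sqnorm_le x n :
  \sum_(0 <= k < n) 2 ^- k.+1 * XD_seminorm k x ^+ 2 <= `|x| ^+ 2.
Proof.
apply: (cvgr_to_ge (@XD_sqnorm_cvg _ _ x)); exists n => // m /= nm.
rewrite [leRHS](big_cat_nat (n := n))//= lerDl; apply: sumr_ge0 => k _.
by rewrite mulr_ge0 ?sqr_ge0// invr_ge0 exprn_ge0.
Qed.

(** Squares serve to state that [x] nearly attains its seminorm on [D k] because
    they enter the norm directly and allow the seminorm to be 0. *)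
Lemma XD_seminorm_attained x k (e : R) : 0 < e ->
  [set t | D k t /\ XD_seminorm k x ^+ 2 - e < x t ^+ 2] !=set0.
Proof.
move=> e0; apply: contrapT => no.
have {}no d : D k d -> x d ^+ 2 <= XD_seminorm k x ^+ 2 - e.
  by move=> Dd; rewrite leNgt; apply/negP => xd; apply: no; exists d.
have [d0 Dd0] := nbhs_base_neq0 D k.
have s0 : 0 <= XD_seminorm k x ^+ 2 - e.
  by rewrite (le_trans _ (no _ Dd0))// sqr_ge0.
have : XD_seminorm k x <= Num.sqrt (XD_seminorm k x ^+ 2 - e).
  by apply: XD_seminorm_le => d Dd; rewrite -sqrtr_sqr ler_wsqrtr// no.
rewrite -(ler_pXn2r (ltn0Sn 1)) ?nnegrE ?sqrtr_ge0 ?XD_seminorm_ge0//.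
by rewrite sqr_sqrtr// lerBrDr gerDl leNgt e0.
Qed.

(** The pieces are [h j = phi j * x], with bumps [phi j] peaking where [x] nearly
    attains its first [N] seminorms. *)
Lemma XD_weakly_null_pieces x (e : R) : 0 < e ->
  exists h : nat -> XD D, [/\ weakly_null h,
    forall j, `|x - 2 *: h j| <= `|x| & forall j, `|x| - e <= `|h j|].
Proof.
move=> e0; have e2 : 0 < e ^+ 2 / 2 by rewrite divr_gt0// exprn_gt0.
(* Half of the allowed loss [e ^+ 2] of squared norm pays for the seminorms beyond
   [N], the other half for those below [N]. *)
have [N xN] : exists N, `|x| ^+ 2 - e ^+ 2 / 2 <
    \sum_(0 <= k < N) 2 ^- k.+1 * XD_seminorm k x ^+ 2.
  have /cvgr_gt/(_ (`|x| ^+ 2 - e ^+ 2 / 2)) := @XD_sqnorm_cvg _ _ x.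
  by rewrite ltrBlDr ltrDl => /(_ e2)[N _ /(_ N (leqnn N))]; exists N.
pose V k := [set t | D k t /\ XD_seminorm k x ^+ 2 - e ^+ 2 / 2 < x t ^+ 2].
have oV k : open (V k).
  apply: openI; first by have [+ _] := nbhs_baseP D; apply; exists k.
  have x2c : continuous (fun t => x t ^+ 2).
    by move=> t; exact: (cvgM (@XD_continuous _ _ x t) (@XD_continuous _ _ x t)).
  by apply: open_comp (@open_gt R _) => t _; exact: x2c.
have [phi [phi0 phi_sum phi1]] :=
  summable_bumps N oV (fun k => XD_seminorm_attained x k e2).
have phi_le1 j t : phi j t <= 1.
  apply: le_trans (phi_sum j.+1 t); rewrite big_nat_recr//= lerDr.
  exact: sumr_ge0.
have phixc j : continuous (fun t => phi j t * x t).
  move=> t; exact: (cvgM (@C01_continuous _ (phi j) t) (@XD_continuous _ _ x t)).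
pose h j : XD D := C01_mk (phixc j).
have hE j t : h j t = phi j t * x t by [].
exists h; split.
- apply: (@bounded_sign_sums_weakly_null _ _ _ `|x|) => n s s1.
  apply: ler_XD_norm_fun => t; rewrite XD_sumE.
  under eq_bigr do rewrite XD_ZE hE mulrA.
  rewrite -mulr_suml normrM ler_piMl//.
  rewrite (le_trans (ler_norm_sum _ _ _))// (le_trans _ (phi_sum n t))//.
  by apply: ler_sum => j _; rewrite normrM (ger0_norm (phi0 _ _)) ler_piMl.
- move=> j; apply: ler_XD_norm_fun => t; rewrite XD_DE XD_NE XD_ZE hE.
  have -> : x t - 2 * (phi j t * x t) = (1 - 2 * phi j t) * x t by ring.
  rewrite normrM ler_piMl// ler_norml.
  by have := phi0 j t; have := phi_le1 j t => ? ?; apply/andP; split; lra.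
- move=> j; have : `|x| ^+ 2 - e ^+ 2 <= `|h j| ^+ 2.
    apply: le_trans (XD_partial_sqnorm_le (h j) N).
    have : \sum_(0 <= k < N) 2 ^- k.+1 * (XD_seminorm k x ^+ 2 - e ^+ 2 / 2) <=
           \sum_(0 <= k < N) 2 ^- k.+1 * XD_seminorm k (h j) ^+ 2.
      rewrite !big_mkord; apply: ler_sum => k _.
      rewrite ler_wpM2l ?invr_ge0 ?exprn_ge0//.
      have [t [Dt xt] phit] := phi1 j k (ltn_ord k).
      rewrite (le_trans (ltW xt))// -real_normK ?num_real//.
      rewrite ler_pXn2r ?nnegrE ?XD_seminorm_ge0//.
      by have := XD_seminorm_ub (h j) Dt; rewrite hE phit mul1r.
    apply: le_trans; under eq_bigr do rewrite mulrBr.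
    rewrite sumrB -mulr_suml sum_half.
    have : 0 <= 2 ^- N * (e ^+ 2 / 2).
      by rewrite mulr_ge0 ?invr_ge0 ?exprn_ge0// ltW.
    lra.
  have := normr_ge0 (h j); have := normr_ge0 x.
  set a := `|h j|; set b := `|x| => b0 a0 ab.
  have [be|eb] := leP b e; first lra.
  rewrite -(ler_pXn2r (ltn0Sn 1)) ?nnegrE ?subr_ge0 ?(ltW eb)//.
  by rewrite (le_trans _ ab)//; nra.
Qed.

Lemma XD_sphere_weakly_dense (U : set (weak (XD D))) x : open U -> U x ->
  `|x| <= 1 -> exists2 y, U y & `|y| = 1.
Proof.
move=> oU Ux x1.
pose one : XD D := C01_mk (@cst_continuous (I01 R) R 1).
have one0 : 0 < `|one|.
  have [t _] : exists t : I01 R, \val t = 0 by apply: I01P; rewrite lexx ler01.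
  rewrite normr_gt0; apply/eqP => /(congr1 (fun y : XD D => y t)).
  by move/eqP; rewrite oner_eq0.
have [h [h0 _ hone]] := XD_weakly_null_pieces one (divr_gt0 one0 (ltr0n _ 2)).
(* [K *: h n] has norm at least 2, so [x + c *: h n] crosses the unit sphere for
   some [c] between 0 and [K]. *)
pose K := 4 / `|one|.
have K0 : 0 <= K by rewrite divr_ge0.
have /choice[c cP] n : exists c, 0 <= c <= K /\ `|x + c *: h n| = 1.
  have [||c] := @IVT _ (fun c => `|x + c *: h n|) 0 K 1 K0.
  - apply: continuous_subspaceT => c; apply: cvg_norm; apply: cvgD.
      exact: cvg_cst.
    by apply: cvgZ; [exact: cvg_id|exact: cvg_cst].
  - rewrite scale0r addr0 ge_min x1 le_max/=; apply/orP; right.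
    have : 2 <= `|K *: h n|.
      rewrite normrZ ger0_norm// /K mulrAC ler_pdivlMr//.
      by have := hone n; lra.
    have := lerB_normD (K *: h n) x; rewrite [K *: _ + _]addrC; lra.
  - by rewrite in_itv/= => cK xc; exists c.
have cK n : `|c n| <= K by have [/andP[? ?] _] := cP n; rewrite ger0_norm.
have [n _ /(_ n (leqnn n)) Un] := weakly_null_shift oU Ux (weakly_nullZ cK h0).
by exists (x + c n *: h n) => //; have [] := cP n.
Qed.

Lemma XD_LD2Pplus : LD2Pplus (XD D).
Proof.
move=> f e d x _ e0 d0 [_ fx] x1.
have d4 : 0 < d / 4 by rewrite divr_gt0.
have [h [h0 xh hx]] := XD_weakly_null_pieces x d4.
have : f (x - 2 *: h n) @[n --> \oo] --> f x.
  have -> : (fun n => f (x - 2 *: h n)) = (fun n => f x - 2 * f (h n)).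
    by apply/funext => n; rewrite -scaleNr dualD dualZ mulNr.
  rewrite -[X in _ --> X]subr0 -[X in _ - X](mulr0 2).
  by apply: cvgB; [exact: cvg_cst|apply: cvgMr; exact: h0].
move=> /cvgr_gt/(_ _ fx)[n _ /(_ n (leqnn n)) fn].
exists (x - 2 *: h n).
  by split => //; rewrite /unit_ball/= (le_trans (xh n))// x1.
have -> : x - (x - 2 *: h n) = 2 *: h n by rewrite opprB addrC subrK.
rewrite normrZ ger0_norm//; have := hx n; rewrite x1; lra.
Qed.

Lemma XD_D2P : D2P (XD D).
Proof.
move=> _ [U oU ->] [x [Ux x1]]; apply/eqP; rewrite eq_le; apply/andP; split.
  apply: ge_ereal_sup => _ [y [z [[_ y1] [_ z1] ->]]]; rewrite lee_fin.
  by rewrite (le_trans (ler_normB _ _))// lerD.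
have [{x1}y Uy y1] := XD_sphere_weakly_dense oU Ux x1.
apply/lee_addgt0Pr => e e0; have e2 : 0 < e / 2 by rewrite divr_gt0.
have [h [h0 yh hy]] := XD_weakly_null_pieces y e2.
have h20 : weakly_null (fun n => -2 *: h n).
  by apply: (@weakly_nullZ _ _ _ (fun=> -2) `|-2|).
have [n _ /(_ n (leqnn n)) Un] := weakly_null_shift oU Uy h20.
rewrite -leeBlDr// -EFinB.
apply: (@le_trans _ _ `|y - (y + -2 *: h n)|%:E).
  rewrite lee_fin opprD addNKr scaleNr opprK normrZ ger0_norm//.
  by have := hy n; rewrite y1; lra.
apply: ereal_sup_ubound; exists y, (y + -2 *: h n); split => //; split => //.
  by rewrite /unit_ball/= y1.
by rewrite /unit_ball/= scaleNr (le_trans (yh n))// y1.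
Qed.

End XD_diameter.

Theorem theorem2p3 (R : realType) (D : nbhs_base R) :
  [/\ MLUR (XD D), D2P (XD D) & LD2Pplus (XD D)].
Proof. by split; [exact: XD_MLUR|exact: XD_D2P|exact: XD_LD2Pplus]. Qed.
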